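(* There exist positive vectors $\boldsymbol{u},\boldsymbol{v}$ with $\|\boldsymbol{u}\|_1=\|\boldsymbol{v}\|_1=1$ such that for any $\varepsilon\in(0,1]$, any feasible $\gamma,\gamma'$ with $\gamma+\gamma'=1$, and any $(\gamma,\gamma')$-dense, $(\boldsymbol{u},\boldsymbol{v})$-scalable matrix $A$, with input $(A,(\boldsymbol{u},\boldsymbol{v}))$ SK takes $O(1/\varepsilon)$ iterations to output a matrix $B$ satisfying $\|\boldsymbol{r}(B)-\boldsymbol{u}\|_1+\|\boldsymbol{c}(B)-\boldsymbol{v}\|_1\le\varepsilon$.
   Context: ''Takes $O(T)$ iterations'' means some SK iterate $A^{(k)}$ with $k\le CT$ ($C$ absolute) satisfies the bound. SK on input $(A,(\boldsymbol{u},\boldsymbol{v}))$: $A^{(0)}_{ij}=u_iA_{ij}/r_i(A)$; odd $k$: $A^{(k)}_{ij}=v_jA^{(k-1)}_{ij}/c_j(A^{(k-1)})$; even $k\ge2$: $A^{(k)}_{ij}=u_iA^{(k-1)}_{ij}/r_i(A^{(k-1)})$ ($r_i,c_j$ row/column sums). $(\boldsymbol{u},\boldsymbol{v})$-scalable: exist positive diagonal $X,Y$ with $XAY$ having row sums $\boldsymbol{u}$, column sums $\boldsymbol{v}$. For nonzero $A\ge0$, $t=\max A_{ij}$: $(\gamma,\gamma',\rho)$-dense w.r.t. $(\boldsymbol{u},\boldsymbol{v})$ means $\gamma=\min_i\sum_k v_k\mathbf{1}[A_{ik}>\rho t]/\|\boldsymbol{v}\|_1$, $\gamma'=\min_j\sum_k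 u_k\mathbf{1}[A_{kj}>\rho t]/\|\boldsymbol{u}\|_1$; $(\gamma,\gamma')$-dense if this holds for some $\rho\in(0,1]$; $(\gamma,\gamma')$ feasible if some matrix is $(\gamma,\gamma')$-dense w.r.t. $(\boldsymbol{u},\boldsymbol{v})$. *)

(* Defs.v *)
From mathcomp Require Import all_boot all_order all_algebra.
From mathcomp Require Import reals.

Set Implicit Arguments.
Unset Strict Implicit.
Unset Printing Implicit Defensive.

Import Order.TTheory GRing.Theory Num.Theory.
Local Open Scope ring_scope.

Section Scaling.
Variables (R : realType) (n m : nat).
Implicit Types (A : 'M[R]_(n, m)) (u : 'rV[R]_n) (v : 'rV[R]_m).

Definition l1norm k (x : 'rV[R]_k) : R := \sum_i `|x 0 i|.

Definition positive_vec k (x : 'rV[R]_k) : Prop := forall i, 0 < x 0 i.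

Definition row_sums A : 'rV[R]_n := \row_i \sum_j A i j.
Definition col_sums A : 'rV[R]_m := \row_j \sum_i A i j.

Definition normalize_rows u A : 'M[R]_(n, m) :=
  \matrix_(i, j) (u 0 i * A i j / row_sums A 0 i).
Definition normalize_cols v A : 'M[R]_(n, m) :=
  \matrix_(i, j) (v 0 j * A i j / col_sums A 0 j).

(* The divisions above are by nonzero sums whenever u, v are positive and A is
   nonnegative and (u, v)-scalable. *)
Fixpoint SK A u v (k : nat) : 'M[R]_(n, m) :=
  match k with
  | 0 => normalize_rows u A
  | k'.+1 => if odd k'.+1 then normalize_cols v (SK A u v k')
             else normalize_rows u (SK A u v k')
  end.

Definition uv_scalable A u v : Prop :=
  exists (x : 'rV[R]_n) (y : 'rV[R]_m),
    [/\ positive_vec x, positive_vec y,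
        row_sums (diag_mx x *m A *m diag_mx y) = u
      & col_sums (diag_mx x *m A *m diag_mx y) = v].

(* For nonnegative A, starting the maximum from 0 does not change it. *)
Definition max_entry A : R :=
  \big[Num.max/0]_(i < n) \big[Num.max/0]_(j < m) A i j.

(* For nonnegative u, v every weight fraction is at most 1, so starting the
   minimum from 1 does not change it (a nonzero A has a row and a column). *)
Definition row_density A v (rho : R) : R :=
  \big[Num.min/1]_(i < n)
    ((\sum_(k < m | rho * max_entry A < A i k) v 0 k) / l1norm v).
Definition col_density A u (rho : R) : R :=
  \big[Num.min/1]_(j < m)
    ((\sum_(k < n | rho * max_entry A < A k j) u 0 k) / l1norm u).

Definition uv_dense_rho A u v (g g' rho : R) : Prop :=
  [/\ (forall i j, 0 <= A i j), A != 0,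
      g = row_density A v rho & g' = col_density A u rho].

Definition uv_dense A u v (g g' : R) : Prop :=
  exists2 rho : R, 0 < rho <= 1 & uv_dense_rho A u v g g' rho.

Definition uv_feasible u v (g g' : R) : Prop :=
  exists A, uv_dense A u v g g'.

Definition SK_error u v (B : 'M[R]_(n, m)) : R :=
  l1norm (row_sums B - u) + l1norm (col_sums B - v).

End Scaling.

(* Main.v *)
(** Take [u = v = (1/2, 1/2)].  Let [A] be a nonnegative 2x2 matrix with row
    sums 1/2 and positive column sums [s] and [t], so that its error is
    [E = |s - t|], and let [a], [c] be the entries of its first column.
    Normalizing the columns turns the error into [E |a - c| / (2 s t)].  Since
    [|a - c| <= min s t] and [(1 + E) min s t = 2 s t], the new error is at most
    [E / (1 + E)]: the inverse of the error grows by at least 1 at every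
    iteration. *)
Require Import Defs.
From mathcomp Require Import all_boot all_order all_algebra.
From mathcomp Require Import reals.
From mathcomp Require Import ring lra.

Set Implicit Arguments.
Unset Strict Implicit.
Unset Printing Implicit Defensive.

Import Order.TTheory GRing.Theory Num.Theory.
Local Open Scope ring_scope.

(** * Preservation of the support under normalization, for general dimensions *)

Section Support.
Variable R : realType.

(** The invariant that keeps every divisor met by SK positive. *)
Definition nonneg_supported n m (A : 'M[R]_(n, m)) : Prop :=
  [/\ forall i j, 0 <= A i j, forall i, 0 < row_sums A 0 i
    & forall j, 0 < col_sums A 0 j].

Lemma row_sums_tr n m (A : 'M[R]_(n, m)) : row_sums A^T = col_sums A.
Proof. by apply/rowP => j; rewrite !mxE; apply: eq_bigr => i _; rewrite mxE. Qed.

Lemma col_sums_tr n m (A : 'M[R]_(n, m)) : col_sums A^T = row_sums A.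
Proof. by rewrite -row_sums_tr trmxK. Qed.

(** Transposition exchanges the two normalizations, so facts about columns follow from facts about
    rows. *)
Lemma normalize_rows_tr n m (v : 'rV[R]_m) (A : 'M[R]_(n, m)) :
  normalize_rows v A^T = (normalize_cols v A)^T.
Proof.
apply/matrixP => i j.
by rewrite [LHS]mxE [RHS]mxE [RHS]mxE row_sums_tr [A^T _ _]mxE.
Qed.

Lemma SK_error_tr n m (u : 'rV[R]_n) (v : 'rV[R]_m) (A : 'M[R]_(n, m)) :
  SK_error v u A^T = SK_error u v A.
Proof. by rewrite /SK_error row_sums_tr col_sums_tr addrC. Qed.

Lemma nonneg_supported_tr n m (A : 'M[R]_(n, m)) :
  nonneg_supported A -> nonneg_supported A^T.
Proof.
case=> A0 rA cA; split=> [i j|i|j]; first by rewrite mxE.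
- by rewrite row_sums_tr.
- by rewrite col_sums_tr.
Qed.

Lemma sum_gt0_term n (F : 'I_n -> R) :
  (forall i, 0 <= F i) -> 0 < \sum_i F i -> exists i, 0 < F i.
Proof.
move=> F0 sF; apply/existsP; rewrite -[X in is_true X]negbK negb_exists.
apply/negP => /forallP Fle; move: sF; rewrite big1 ?ltxx // => i _.
by apply/eqP; rewrite eq_le F0 andbT leNgt Fle.
Qed.

Lemma term_sum_gt0 n (F : 'I_n -> R) i :
  (forall j, 0 <= F j) -> 0 < F i -> 0 < \sum_j F j.
Proof. by move=> F0 Fi; rewrite (bigD1 i) //= ltr_wpDr // sumr_ge0. Qed.

Lemma row_sums_normalize_rows n m (u : 'rV[R]_n) (A : 'M[R]_(n, m)) :
  nonneg_supported A -> row_sums (normalize_rows u A) = u.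
Proof.
case=> _ rA _; apply/rowP => i; have := rA i; rewrite mxE => ri.
rewrite mxE (eq_bigr (fun j => u 0 i / (\sum_j A i j) * A i j)).
  by rewrite -mulr_sumr divfK // gt_eqF.
by move=> j _; rewrite !mxE mulrAC.
Qed.

(** Each entry is multiplied by a positive factor, so a positive entry of a column stays
    positive. *)
Lemma nonneg_supported_normalize_rows n m (u : 'rV[R]_n) (A : 'M[R]_(n, m)) :
  positive_vec u -> nonneg_supported A ->
  nonneg_supported (normalize_rows u A).
Proof.
move=> u0 sA; have [A0 rA cA] := sA.
have N0 i j : 0 <= normalize_rows u A i j.
  by rewrite mxE divr_ge0 ?mulr_ge0 // ltW.
split=> // [i|j]; first by rewrite row_sums_normalize_rows.
have [|i Aij] := @sum_gt0_term _ (A^~ j) (A0^~ j).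
  by have := cA j; rewrite mxE.
rewrite mxE; apply: (term_sum_gt0 (i := i)) => //.
by rewrite mxE divr_gt0 ?mulr_gt0.
Qed.

Lemma nonneg_supported_normalize_cols n m (v : 'rV[R]_m) (A : 'M[R]_(n, m)) :
  positive_vec v -> nonneg_supported A ->
  nonneg_supported (normalize_cols v A).
Proof.
move=> v0 /nonneg_supported_tr/(nonneg_supported_normalize_rows v0).
by rewrite normalize_rows_tr => /nonneg_supported_tr; rewrite trmxK.
Qed.

(** The scaled matrix has the same positive entries as [A], and its row and column sums, being [u]
    and [v], are positive. *)
Lemma uv_scalable_supported n m (u : 'rV[R]_n) (v : 'rV[R]_m)
    (A : 'M[R]_(n, m)) :
  positive_vec u -> positive_vec v -> (forall i j, 0 <= A i j) ->
  uv_scalable A u v -> nonneg_supported A.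
Proof.
move=> u0 v0 A0 [x [y [x0 y0 Eu Ev]]].
have E i j : (diag_mx x *m A *m diag_mx y) i j = x 0 i * A i j * y 0 j.
  by rewrite mul_mx_diag mul_diag_mx !mxE.
have pos i j : 0 < (diag_mx x *m A *m diag_mx y) i j -> 0 < A i j.
  by rewrite E pmulr_lgt0 // pmulr_rgt0.
have B0 i j : 0 <= (diag_mx x *m A *m diag_mx y) i j.
  by rewrite E !mulr_ge0 // ltW.
split=> // [i|j]; rewrite mxE.
- have := u0 i; rewrite -Eu mxE => /(sum_gt0_term (B0 i)) [j /pos].
  exact: term_sum_gt0.
- have := v0 j; rewrite -Ev mxE => /(sum_gt0_term (B0^~ j)) [i /pos].
  exact: (@term_sum_gt0 _ (A^~ j)).
Qed.

End Support.

(** * Decay of the error for 2x2 matrices with uniform marginals *)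

Section HalfHalf.
Variable R : realType.

Definition half2 : 'rV[R]_2 := const_mx 2^-1.

Lemma positive_half2 : positive_vec half2.
Proof. by move=> i; rewrite mxE invr_gt0. Qed.

Lemma sum2E (F : 'I_2 -> R) : \sum_i F i = F 0 + F 1.
Proof. by rewrite big_ord_recl big_ord1; congr (_ + F _); apply/val_inj. Qed.

Lemma l1norm_half2 : l1norm half2 = 1.
Proof. by rewrite /l1norm sum2E !mxE ger0_norm ?invr_ge0 //; lra. Qed.

(** For the matrix with rows [(a, b)] and [(c, d)], [x] and [y] are the row sums after normalizing
    the columns, and [E] is the error before. *)
Lemma half_error (a b c d : R) :
  0 <= a -> 0 <= b -> 0 <= c -> 0 <= d ->
  a + b = 2^-1 -> c + d = 2^-1 -> 0 < a + c -> 0 < b + d ->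
  let x := 2^-1 * a / (a + c) + 2^-1 * b / (b + d) in
  let y := 2^-1 * c / (a + c) + 2^-1 * d / (b + d) in
  let E := `|a + c - 2^-1| + `|b + d - 2^-1| in
  is_true ((`|x - 2^-1| + `|y - 2^-1|) * (1 + E) <= E).
Proof.
move=> a0 b0 c0 d0 ab cd s0 t0 x y E.
pose s := a + c; pose t := b + d.
have {}s0 : 0 < s := s0; have {}t0 : 0 < t := t0.
have s_neq0 : s != 0 by rewrite gt_eqF.
have t_neq0 : t != 0 by rewrite gt_eqF.
have st : s + t = 1 by rewrite /s /t; lra.
have EE : E = `|s - t|.
  have -> : s - t = (s - 2^-1) + (s - 2^-1) by lra.
  rewrite /E -/s -/t (_ : t - 2^-1 = - (s - 2^-1)); last lra.
  by rewrite normrN -mulr2n -[in RHS]mulr2n normrMn.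
have K0 : 0 < 4 * s * t by rewrite !mulr_gt0.
(* Eliminating [b], [c], [t] makes this an identity in [a] and [s], where [a - c = 2 a - s] and
   [t - s = 1 - 2 s]. *)
have xE : x - 2^-1 = (t - s) * (a - c) / (4 * s * t).
  have bE : b = 2^-1 - a by lra.
  have cE : c = s - a by rewrite /s; lra.
  have tE : t = 1 - s by lra.
  move: t_neq0; rewrite /x -/s -/t tE cE bE => t_neq0.
  by field; rewrite s_neq0 t_neq0.
have yE : y - 2^-1 = - (x - 2^-1).
  have : x + y = 1.
    rewrite /x /y addrACA -!mulrDl -!mulrDr -/s -/t !mulfK //; lra.
  by move=> xy; lra.
rewrite yE normrN xE normrM normfV normrM distrC -EE (gtr0_norm K0).
have E0 : 0 <= E by rewrite EE.
(* The new error is [E * |a - c| / (2 s t)]. *)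
suff H : `|a - c| * (1 + E) <= 2 * s * t.
  have -> : (E * `|a - c| / (4 * s * t) + E * `|a - c| / (4 * s * t)) * (1 + E)
      = E * ((`|a - c| * (1 + E)) / (2 * s * t)).
    by field; rewrite s_neq0 t_neq0.
  by rewrite ler_piMr // ler_pdivrMr ?mul1r // !mulr_gt0.
have as_ : `|a - c| <= s by rewrite ler_norml /s; apply/andP; split; lra.
have at_ : `|a - c| <= t by rewrite ler_norml /t; apply/andP; split; lra.
(* As [s + t = 1], [1 + E] is twice the larger of [s] and [t], while [|a - c|] is at most the
   smaller. *)
rewrite EE; case: (lerP t s) => h.
  rewrite (_ : 1 + _ = 2 * s); [|lra]. nra.
rewrite (_ : 1 + _ = 2 * t); [|lra]. nra.
Qed.

Lemma SK_error_normalize_cols (A : 'M[R]_2) :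
  nonneg_supported A -> row_sums A = half2 ->
  SK_error half2 half2 (normalize_cols half2 A) *
    (1 + SK_error half2 half2 A) <= SK_error half2 half2 A.
Proof.
move=> sA rA; have [A0 _ cA] := sA.
have cN : col_sums (normalize_cols half2 A) = half2.
  rewrite -row_sums_tr -normalize_rows_tr row_sums_normalize_rows //.
  exact: nonneg_supported_tr.
have l0 (x : 'rV[R]_2) : l1norm (x - x) = 0.
  by rewrite subrr /l1norm big1 // => i _; rewrite mxE normr0.
rewrite /SK_error cN rA l0 addr0 add0r.
(* What remains is the row part of the new error and the column part of the old one, as in
   [half_error]. *)
have colE j : col_sums A 0 j = A 0 j + A 1 j by rewrite mxE sum2E.
have rowE i : A i 0 + A i 1 = 2^-1.
  by have /rowP/(_ i) := rA; rewrite !mxE sum2E.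
have subE (x : 'rV[R]_2) j : (x - half2) 0 j = x 0 j - 2^-1 by rewrite !mxE.
rewrite /l1norm !sum2E !subE.
have := @half_error (A 0 0) (A 0 1) (A 1 0) (A 1 1).
rewrite !rowE -!colE => /(_ (A0 _ _) (A0 _ _) (A0 _ _) (A0 _ _)).
move=> /(_ erefl erefl (cA _) (cA _)) /=.
by rewrite !mxE !sum2E !mxE !sum2E.
Qed.

Lemma SK_error_normalize_rows (A : 'M[R]_2) :
  nonneg_supported A -> col_sums A = half2 ->
  SK_error half2 half2 (normalize_rows half2 A) *
    (1 + SK_error half2 half2 A) <= SK_error half2 half2 A.
Proof.
move=> /nonneg_supported_tr sA cA.
have := SK_error_normalize_cols sA; rewrite row_sums_tr => /(_ cA).
by rewrite !SK_error_tr -SK_error_tr -normalize_rows_tr trmxK.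
Qed.

(** Each column sum lies between 0 and 1, hence within 1/2 of its target. *)
Lemma SK_error_row_stochastic (A : 'M[R]_2) :
  nonneg_supported A -> row_sums A = half2 -> SK_error half2 half2 A <= 1.
Proof.
move=> [A0 _ _] rA; rewrite /SK_error rA subrr.
have rowE i : A i 0 + A i 1 = 2^-1.
  by have /rowP/(_ i) := rA; rewrite !mxE sum2E.
rewrite /l1norm !sum2E !mxE !sum2E normr0 !add0r.
have := rowE 0; have := rowE 1.
have := A0 0 0; have := A0 0 1; have := A0 1 0; have := A0 1 1.
move=> *; rewrite [leRHS](_ : 1 = 2^-1 + 2^-1 :> R); last lra.
by apply: lerD; rewrite ler_norml; apply/andP; split; lra.
Qed.

Lemma SK_half2_error_le (A : 'M[R]_2) k : nonneg_supported A ->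
  SK_error half2 half2 (SK A half2 half2 k) <= k.+1%:R^-1.
Proof.
move=> sA; have u0 := positive_half2.
(* The induction also carries the support and the marginal that is exact: columns for odd [k], rows
   for even [k]. *)
suff [_ _] : [/\ nonneg_supported (SK A half2 half2 k),
    (if odd k then col_sums (SK A half2 half2 k)
     else row_sums (SK A half2 half2 k)) = half2
  & SK_error half2 half2 (SK A half2 half2 k) <= k.+1%:R^-1] by [].
have step (E E' : R) l : 0 <= E -> E <= l.+1%:R^-1 -> E' * (1 + E) <= E ->
    E' <= l.+2%:R^-1.
  move=> E0 El; rewrite -ler_pdivlMr ?ltr_wpDr // => /le_trans; apply.
  rewrite ler_pdivrMr ?ltr_wpDr // mulrC ler_pdivlMr //.
  (* The goal is now [E * (l + 2) <= 1 + E], that is, [E * (l + 1) <= 1]. *)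
  rewrite -(ler_pM2r (x := l.+1%:R)) // mulVf ?pnatr_eq0 // in El.
  by rewrite -natr1; lra.
have err0 B : 0 <= SK_error half2 half2 B.
  by rewrite addr_ge0 // sumr_ge0.
elim: k => [|k [sk mk ek]].
  have s0 := nonneg_supported_normalize_rows u0 sA.
  have r0 := row_sums_normalize_rows half2 sA.
  by split=> //; rewrite invr1 SK_error_row_stochastic.
rewrite [SK _ _ _ k.+1]/=; move: mk; rewrite [odd k.+1]/=.
case: (odd k) => /= mk; split.
- exact: nonneg_supported_normalize_rows.
- exact: row_sums_normalize_rows.
- exact: step (SK_error_normalize_rows sk mk).
- exact: nonneg_supported_normalize_cols.
- rewrite -row_sums_tr -normalize_rows_tr row_sums_normalize_rows //.
  exact: nonneg_supported_tr.
- exact: step (SK_error_normalize_cols sk mk).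
Qed.

(** With threshold 1/2, each row and column of the identity has one large entry, which carries half
    of the weight. *)
Lemma uv_dense_scalar_half2 : uv_dense (1%:M : 'M[R]_2) half2 half2 2^-1 2^-1.
Proof.
have d01 : ((0 : 'I_2) == 1) = false by [].
have d10 : ((1 : 'I_2) == 0) = false by [].
have big2 op (x0 : R) (F : 'I_2 -> R) :
    \big[op/x0]_(i < 2) F i = op (F 0) (op (F 1) x0).
  rewrite !big_ord_recl big_ord0; congr (op _ (op (F _) _)).
  exact/val_inj.
have big2P (P : pred 'I_2) (F : 'I_2 -> R) : \sum_(k < 2 | P k) F k =
    (if P 0 then F 0 else 0) + (if P 1 then F 1 else 0).
  by rewrite big_mkcond sum2E.
have maxE : max_entry (1%:M : 'M[R]_2) = 1.
  rewrite /max_entry !big2 !mxE !eqxx d01 d10 /=.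
  by rewrite maxxx (max_l ler01) (max_r ler01) (max_l ler01) maxxx.
have lt1 : (2^-1 * 1 < 1 :> R) = true by apply/idP; lra.
have lt0 : (2^-1 * 1 < 0 :> R) = false by apply/negbTE; rewrite -leNgt; lra.
have le1 : (2^-1 <= 1 :> R) by lra.
exists 2^-1; first by apply/andP; split; lra.
split.
- by move=> i j; rewrite mxE; case: (_ == _).
- by rewrite matrix_nonzero1.
all: rewrite /row_density /col_density maxE l1norm_half2 big2 !big2P !mxE.
all: rewrite !eqxx d01 d10 !mulr1n !mulr0n lt1 lt0 addr0 add0r.
(* The starting value 1 of the minimum is absorbed since 1/2 is smaller. *)
all: by rewrite !divr1 !min_l.
Qed.

End HalfHalf.

(* The clause asserting that a feasible critical pair exists excludes vectors,
   such as those of dimension 1, for which the last clause is vacuous. *)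
Theorem theorem1p8 (R : realType) :
  exists2 C : R, 0 < C &
  exists (n m : nat) (u : 'rV[R]_n) (v : 'rV[R]_m),
    [/\ positive_vec u /\ positive_vec v,
        l1norm u = 1 /\ l1norm v = 1,
        (exists g g' : R, uv_feasible u v g g' /\ g + g' = 1)
      & forall (eps : R) (g g' : R) (A : 'M[R]_(n, m)),
          0 < eps <= 1 ->
          uv_feasible u v g g' ->
          g + g' = 1 ->
          uv_dense A u v g g' ->
          uv_scalable A u v ->
          exists k : nat,
            k%:R <= C * (1 / eps) /\ SK_error u v (SK A u v k) <= eps].
Proof.
exists 1 => //; exists 2%N, 2%N, (half2 R), (half2 R).
have u0 := @positive_half2 R; have u1 := l1norm_half2 R.
split=> //; first exists 2^-1, 2^-1.
  split; last lra.
  by exists 1%:M; exact: uv_dense_scalar_half2.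
move=> eps g g' A /andP[e0 _] _ _ [rho _ [A0 _ _ _]] sA.
have inv0 : 0 <= eps^-1 by rewrite invr_ge0 ltW.
(* With [k] the integer part of [1 / eps], [k <= 1 / eps < k + 1]: the left part gives the count
   with [C = 1], the right part gives [1 / (k + 1) < eps]. *)
exists (Num.truncn eps^-1); have /andP[lo hi] := truncn_itv inv0.
rewrite !mul1r; split=> //.
apply: le_trans (SK_half2_error_le _ (uv_scalable_supported u0 u0 A0 sA)) _.
by rewrite -[leRHS]invrK lef_pV2 ?posrE ?invr_gt0 // ltW.
Qed.
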